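(* Consider the contextual bilateral trade problem in the one-bit feedback model. There exists an efficiency-maximizing algorithm that achieves regret $O(d\,6^d)$ and enforces per-round budget balance.
   Context: Contextual bilateral trade: Let $\mathbb{B}=\{w\in\mathbb{R}^d:\|w\|_2\le 1\}$. There are two fixed vectors $s,b\in\mathbb{B}$ unknown to the learner. At each time $t=1,\dots,T$, the learner observes a context $x_t\in\mathbb{B}$ (the contexts and $s,b$ are fixed in advance by an oblivious adversary; this is an instance), and posts a price $p_t$ to the seller and $q_t$ to the buyer. Valuations: $s_t=\langle s,x_t\rangle$, $b_t=\langle b,x_t\rangle$; the trade happens iff $s_t\le p_t$ and $q_t\le b_t$. Gain from trade: $\mathrm{GFT}_t(p_t,q_t)=(b_t-s_t)\,\mathbb{1}\{s_t\le p_t\}\mathbb{1}\{q_t\le b_t\}$. One-bit feedback: after each round the learner observes only $\mathbb{1}\{s_t\le p_t\}\cdot\mathbb{1}\{q_t\le b_t\}$. Regret of a (possibly randomized) algorithm $\mathcal{A}$: $R_T(\mathcal{A})=\sup_{\mathcal{I}}\mathbb{E}\big[\sum_{t=1}^T (b_t-s_t)_+-\sum_{t=1}^T\mathrm{GFT}_t(p_t,q_t)\big]$, expectation over the algorithm's randomness. Per-round budget balance: $p_t\le q_t$ for every $t$. The $O(\cdot)$ hides absolute constants independent of $d$ and $T$. *)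

(* Defs.v *)
From HB Require Import structures.
From mathcomp Require Import all_boot all_order all_algebra.
From mathcomp Require Import all_classical all_reals all_analysis.
Set Implicit Arguments. Unset Strict Implicit. Unset Printing Implicit Defensive.
Import Order.TTheory GRing.Theory Num.Theory.
Local Open Scope ring_scope.

Section Trade.
Variables (R : realType) (d : nat).

Definition dotv (u v : 'rV[R]_d) : R := \sum_(i < d) u ord0 i * v ord0 i.

Definition in_ball (w : 'rV[R]_d) : Prop := \sum_(i < d) (w ord0 i) ^+ 2 <= 1.

(* A (possibly randomized) learner: the internal randomness is a seed
   omega drawn from a probability space; given the seed, the history of
   past (context, one-bit feedback) pairs and the current context, it
   posts the pair (p_t, q_t) = (seller price, buyer price). *)
Definition policy (Omega : Type) :=
  Omega -> seq ('rV[R]_d * bool) -> 'rV[R]_d -> R * R.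

Definition trade (s b x : 'rV[R]_d) (pq : R * R) : bool :=
  (dotv s x <= pq.1) && (pq.2 <= dotv b x).

(* history observed before round t (rounds indexed 0,1,...) *)
Fixpoint history (Omega : Type) (A : policy Omega) (w : Omega)
    (s b : 'rV[R]_d) (x : nat -> 'rV[R]_d) (t : nat) : seq ('rV[R]_d * bool) :=
  match t with
  | 0 => [::]
  | t'.+1 => let h := history A w s b x t' in
             rcons h (x t', trade s b (x t') (A w h (x t')))
  end.

Definition prices (Omega : Type) (A : policy Omega) (w : Omega)
    (s b : 'rV[R]_d) (x : nat -> 'rV[R]_d) (t : nat) : R * R :=
  A w (history A w s b x t) (x t).

Definition gft (s b x : 'rV[R]_d) (pq : R * R) : R :=
  if trade s b x pq then dotv b x - dotv s x else 0.

Definition realized_regret (Omega : Type) (A : policy Omega) (w : Omega)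
    (s b : 'rV[R]_d) (x : nat -> 'rV[R]_d) (T : nat) : R :=
  \sum_(t < T) Num.max 0 (dotv b (x t) - dotv s (x t))
  - \sum_(t < T) gft s b (x t) (prices A w s b x t).

End Trade.

(* Main.v *)
Require Import Defs.
From HB Require Import structures.
From mathcomp Require Import all_boot all_order all_algebra.
From mathcomp Require Import all_classical all_reals all_analysis.
From mathcomp Require Import measurable_realfun ring lra zify.
Import Order.TTheory GRing.Theory Num.Theory.
Local Open Scope ring_scope.
Local Open Scope classical_set_scope.

(** The learner always posts equal prices and keeps convex sets [Ks], [Kb] of
    candidates for [s] and [b].  Given a context, let [W] be the larger of the
    widths of the two sets in its direction.  If the lower end of [Kb] exceeds
    that of [Ks] by [W / 4], it is posted: the buyer surely accepts, so a failure
    is the seller's and cuts [Ks]; dually at the upper ends.  Otherwise the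
    price is random in [min Ks, max Kb], an interval of length at most
    [5 W / 4]: a gain [g] is then realised with probability at least about
    [g / (2 W)], so the expected loss before a trade is [O(W)], and any trade
    cuts [W / 4] off [Ks] or [Kb].

    It remains to bound the sum of [W] over all such cuts.  At scale [2 ^ -i],
    count the points of a grid of mesh [~ 2 ^ -i / d] that are close to the set.
    A homothety of ratio [1 / 5] maps what remains after the cut into what is
    removed, so a cut with [W ~ 2 ^ -i] divides this count by [1 + 5 ^ -d], and
    there are [O(5 ^ d * d * (d + i))] of them.  Summing over [i] gives
    [O(d ^ 2 * 5 ^ d)], which is [O(d * 6 ^ d)]. *)

(** * Grid counts of convex sets *)

Section Geometry.
Context {R : realType} {d : nat}.
Implicit Types (u v x y : 'rV[R]_d) (K : set 'rV[R]_d) (p r W : R).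

Definition cut_le K x p := K `&` [set u | dotv u x <= p].

Lemma dotv_comb (a c : R) u v x :
  dotv (a *: u + c *: v) x = a * dotv u x + c * dotv v x.
Proof.
rewrite /dotv !mulr_sumr -big_split; apply: eq_bigr => i _ /=.
by rewrite !mxE mulrDl !mulrA.
Qed.

Lemma dotvN u x : dotv u (- x) = - dotv u x.
Proof. by rewrite /dotv -sumrN; apply: eq_bigr => i _; rewrite mxE mulrN. Qed.

Lemma in_ballN x : in_ball x -> in_ball (- x).
Proof.
by rewrite /in_ball; under [in X in _ -> X]eq_bigr do rewrite mxE sqrrN.
Qed.

Lemma in_ball_coord {u} (i : 'I_d) : in_ball u -> `|u ord0 i| <= 1.
Proof.
rewrite /in_ball (bigD1 i)//= => h.
have : 0 <= \sum_(j < d | j != i) u ord0 j ^+ 2.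
  by apply: sumr_ge0 => j _; exact: sqr_ge0.
move: h; move: (\sum_(_ < _ | _) _) => S h S0.
have : u ord0 i ^+ 2 <= 1 by lra.
by move=> *; rewrite ler_norml; apply/andP; split; nra.
Qed.

Lemma normr_dotv_le1 {u x} : in_ball u -> in_ball x -> `|dotv u x| <= 1.
Proof.
rewrite /in_ball => hu hx; apply: le_trans (ler_norm_sum _ _ _) _.
apply: (@le_trans _ _ (\sum_(i < d) (u ord0 i ^+ 2 / 2 + x ord0 i ^+ 2 / 2))).
  apply: ler_sum => i _; rewrite ler_norml.
  have := sqr_ge0 (u ord0 i + x ord0 i); have := sqr_ge0 (u ord0 i - x ord0 i).
  by move=> *; apply/andP; split; nra.
by rewrite big_split/= -!mulr_suml; lra.
Qed.

Lemma in_ball_convex u v (t : R) : 0 <= t <= 1 ->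
  in_ball u -> in_ball v -> in_ball ((1 - t) *: u + t *: v).
Proof.
move=> /andP[t0 t1]; rewrite /in_ball => hu hv.
apply: (@le_trans _ _
  (\sum_(i < d) ((1 - t) * u ord0 i ^+ 2 + t * v ord0 i ^+ 2))).
  apply: ler_sum => i _; rewrite !mxE -subr_ge0.
  set a := u _ _; set b := v _ _.
  have -> : (1 - t) * a ^+ 2 + t * b ^+ 2 - ((1 - t) * a + t * b) ^+ 2 =
    (1 - t) * t * (a - b) ^+ 2 by ring.
  by apply: mulr_ge0; [apply: mulr_ge0; lra|exact: sqr_ge0].
rewrite big_split/= -!mulr_sumr; nra.
Qed.

Lemma dotv_near u v x r : in_ball x ->
  (forall i, `|u ord0 i - v ord0 i| <= r) ->
  `|dotv u x - dotv v x| <= d%:R * r.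
Proof.
move=> hx h; rewrite /dotv -sumrB; apply: le_trans (ler_norm_sum _ _ _) _.
rewrite -[X in X%:R * _]card_ord mulr_natl -sumr_const; apply: ler_sum => i _.
rewrite -mulrBl normrM -[leRHS]mulr1; apply: ler_pM => //.
exact: in_ball_coord.
Qed.

Section Grid.
Variable n : nat.
Hypothesis n0 : (0 < n)%N.

Let n0R : 0 < n%:R :> R. Proof. by rewrite ltr0n. Qed.

Definition grid_pt (g : {ffun 'I_d -> 'I_(n.*2.+1)}) : 'rV[R]_d :=
  \row_i ((g i)%:R / n%:R - 1).

Definition grid_floor v : {ffun 'I_d -> 'I_(n.*2.+1)} :=
  [ffun i => inord (Num.truncn (n%:R * (v ord0 i + 1)))].

(** This count stands in for volume: it stays positive on any nonempty subset of the ball, however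
    thin, so its logarithm is a usable potential. The radius [2 / n] survives a contraction by 1/5
    followed by rounding, as [2/5 + 1 <= 2]. *)
Definition grid_nbhd K : {set {ffun 'I_d -> 'I_(n.*2.+1)}} :=
  [set g | `[< exists2 k, K k &
    forall i, `|grid_pt g ord0 i - k ord0 i| <= 2 / n%:R >]]%SET.

Lemma grid_nbhdP {K g} : reflect (exists2 k, K k &
    forall i, `|grid_pt g ord0 i - k ord0 i| <= 2 / n%:R) (g \in grid_nbhd K).
Proof. by rewrite finset.in_set; exact: asboolP. Qed.

Lemma grid_floorE v i : `|v ord0 i| <= 1 ->
  grid_floor v i = Num.truncn (n%:R * (v ord0 i + 1)) :> nat.
Proof.
rewrite ler_norml => /andP[v1 v2]; rewrite ffunE inordK// ltnS.
rewrite -(ler_nat R); apply: (@le_trans _ _ (n%:R * (v ord0 i + 1))).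
  by rewrite truncn_le mulr_ge0//; lra.
by rewrite -muln2 natrM ler_pM2l//; lra.
Qed.

Lemma grid_floor_near v i : `|v ord0 i| <= 1 ->
  `|grid_pt (grid_floor v) ord0 i - v ord0 i| <= 1 / n%:R.
Proof.
move=> v1; rewrite mxE grid_floorE//.
have /andP[] : (Num.truncn (n%:R * (v ord0 i + 1)))%:R <= n%:R * (v ord0 i + 1)
    < (Num.truncn (n%:R * (v ord0 i + 1))).+1%:R.
  by apply: truncn_itv; rewrite mulr_ge0//; move: v1; rewrite ler_norml; lra.
move: (Num.truncn _) => m h1; rewrite -natr1 => h2.
have -> : m%:R / n%:R - 1 - v ord0 i =
    (m%:R - n%:R * (v ord0 i + 1)) / n%:R.
  by field; rewrite gt_eqF.
rewrite normrM (@ger0_norm _ n%:R^-1) ?invr_ge0// ler_pM2r ?invr_gt0//.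
by rewrite ler_norml; lra.
Qed.

Lemma sub_grid_nbhd K K' : K `<=` K' -> grid_nbhd K \subset grid_nbhd K'.
Proof.
move=> KK'; apply/fintype.subsetP => g /grid_nbhdP[k kK h].
by apply/grid_nbhdP; exists k => //; exact: KK'.
Qed.

Lemma card_grid_nbhd_gt0 K u : K u -> in_ball u -> (0 < #|grid_nbhd K|)%N.
Proof.
move=> Ku bu; apply/card_gt0P; exists (grid_floor u).
apply/grid_nbhdP; exists u => // i.
apply: le_trans (grid_floor_near _ _ (in_ball_coord i bu)) _.
by rewrite ler_pM2r ?invr_gt0//; lra.
Qed.

(* The contraction of ratio 1/5 centred at [y] maps the part of [K] below the
   cut into the part above it; on the grid, rounding makes it at most
   [5 ^ d]-to-one, the residues modulo 5 telling the preimages apart. *)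
Lemma card_grid_nbhd_cut K x y p W :
  K `<=` @in_ball R d ->
  (forall u v (t : R), 0 <= t <= 1 -> K u -> K v -> K ((1 - t) *: u + t *: v)) ->
  in_ball x -> K y -> (forall k, K k -> dotv y x - dotv k x <= W) ->
  p + W / 5 + 4 * d%:R / n%:R < dotv y x ->
  (#|grid_nbhd (cut_le K x p)| <= 5 ^ d *
   (#|grid_nbhd K| - #|grid_nbhd (cut_le K x p)|))%N.
Proof.
move=> Kb Kc bx Ky yW hp; set K' := cut_le K x p.
pose ctr k := (1 - 5^-1) *: y + 5^-1 *: k : 'rV[R]_d.
have t01 : 0 <= (5^-1 : R) <= 1 by lra.
pose f g := (grid_floor (ctr (grid_pt g)),
             [ffun i : 'I_d => inord (g i %% 5) : 'I_5]).
have box_g g i : `|grid_pt g ord0 i| <= 1.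
  rewrite mxE ler_norml; have := ltn_ord (g i); rewrite ltnS => gi.
  have h0 : (0:R) <= (g i)%:R / n%:R by rewrite divr_ge0.
  have h2 : (g i)%:R / n%:R <= (2:R).
    by rewrite ler_pdivrMr// -natrM ler_nat mul2n.
  lra.
have box_ctr g i : `|ctr (grid_pt g) ord0 i| <= 1.
  rewrite !mxE; have := box_g g i; have := in_ball_coord i (Kb _ Ky).
  by rewrite mxE !ler_norml; lra.
have finj : {in grid_nbhd K' &, injective f}.
  move=> g1 g2 _ _ [e1 e2]; apply/ffunP => i; apply/val_inj => /=.
  move/(congr1 (fun h : {ffun _} => nat_of_ord (h i))): e2.
  rewrite !ffunE !inordK ?ltn_pmod// => e2.
  move/(congr1 (fun h : {ffun _} => nat_of_ord (h i))): e1.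
  rewrite !grid_floorE//.
  (* Splitting [g i] by 5 isolates an integer shift: once the residues agree, equal floors force
     equal quotients. *)
  have E g : n%:R * (ctr (grid_pt g) ord0 i + 1) =
      n%:R * 4 / 5 * (y ord0 i + 1) + (g i %% 5)%:R / 5 + (g i %/ 5)%:R.
    rewrite !mxE; have -> : (g i)%:R = (g i %/ 5)%:R * 5 + (g i %% 5)%:R :> R.
      by rewrite [in LHS](divn_eq (g i) 5) natrD natrM.
    by field; rewrite gt_eqF.
  have c0 : 0 <= n%:R * 4 / 5 * (y ord0 i + 1) + (g2 i %% 5)%:R / 5 :> R.
    rewrite addr_ge0// ?divr_ge0//.
    have := in_ball_coord i (Kb _ Ky); rewrite ler_norml => /andP[y1 _].
    by rewrite mulr_ge0// ?divr_ge0 ?mulr_ge0//; lra.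
  rewrite !E e2; move: (_ * _ + _) c0 => a a0.
  rewrite ![a + _]addrC !truncnD ?nnegrE ?natr_nat// !natrK.
  move=> /eqP; rewrite eqn_add2r => /eqP e1.
  by rewrite (divn_eq (g1 i) 5) (divn_eq (g2 i) 5) e1 e2.
have sK : grid_nbhd K' \subset grid_nbhd K.
  by apply: sub_grid_nbhd; exact: subIsetl.
have fK : f @: grid_nbhd K' \subset
    finset.setX (grid_nbhd K :\: grid_nbhd K')%SET [set: {ffun 'I_d -> 'I_5}]%SET.
  apply/fintype.subsetP => _ /imsetP[g /grid_nbhdP[k [kK kp] gk] ->].
  rewrite finset.in_setX finset.in_setD finset.in_setT andbT.
  have kc : K (ctr k) by apply: Kc.
  have near_c i : `|grid_pt (grid_floor (ctr (grid_pt g))) ord0 i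
                    - ctr k ord0 i| <= 2 / n%:R.
    have := grid_floor_near _ _ (box_ctr g i); have := gk i.
    have : 0 < n%:R^-1 :> R by rewrite invr_gt0.
    have ctrE v : ctr v ord0 i = (1 - 5^-1) * y ord0 i + 5^-1 * v ord0 i.
      by rewrite !mxE.
    by rewrite !ctrE !ler_norml; lra.
  apply/andP; split; last by apply/grid_nbhdP; exists (ctr k).
  (* A point [k2] below the cut and near the rounded image would satisfy [dotv k2 x >= dotv y x - W
     / 5 - 4 * d / n > p]: each of the two errors [2 / n] per coordinate costs at most [d * (2 / n)]
     along [x]. *)
  apply/grid_nbhdP => -[k2 [k2K /= k2p] h2].
  have d1 := dotv_near _ _ _ _ bx near_c.
  have d2 := dotv_near _ _ _ _ bx h2.
  have hk := yW _ kK.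
  move: d1 d2; rewrite dotv_comb !ler_norml => /andP[d1 _] /andP[_ d2].
  have e4 : d%:R * (2 / n%:R) = (4 * d%:R / n%:R) / 2 :> R.
    by field; rewrite gt_eqF.
  rewrite e4 in d1 d2; lra.
have := subset_leq_card fK; rewrite card_in_imset// cardsX cardsT.
rewrite card_ffun !card_ord cardsD (finset.setIidPr sK) => h.
by rewrite mulnC.
Qed.

End Grid.
End Geometry.

(** * The potential *)

Section Potential.
Context {R : realType} {d : nat}.
Implicit Types (u v x y : 'rV[R]_d) (K : set 'rV[R]_d) (p r W : R).

(** The support function of [K]. Its counterpart [lower] goes through [- x], so facts about upper
    ends and [cut_le] transfer to lower ends and [cut_ge]. *)
Definition upper K x : R := sup [set dotv u x | u in K].
Definition lower K x : R := - upper K (- x).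

Definition convex_body K := [/\ K `<=` @in_ball R d, K !=set0 &
  forall u v (t : R), 0 <= t <= 1 -> K u -> K v -> K ((1 - t) *: u + t *: v)].

Lemma convex_body_ball : convex_body (@in_ball R d).
Proof.
split=> //; last by move=> *; exact: in_ball_convex.
by exists 0; rewrite /in_ball big1// => i _; rewrite mxE expr0n.
Qed.

Lemma convex_body_cut K x p u : convex_body K -> K u -> dotv u x <= p ->
  convex_body (cut_le K x p).
Proof.
move=> [Kb _ Kc] Ku up; split; [by move=> v [/Kb]|by exists u|].
move=> v w t t01 [Kv /= vp] [Kw /= wp]; split; first exact: Kc.
by rewrite /= dotv_comb; case/andP: t01 => *; nra.
Qed.

Lemma le_upper K x u : convex_body K -> in_ball x -> K u ->
  dotv u x <= upper K x.
Proof.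
move=> [Kb _ _] bx Ku; apply: ub_le_sup; last by exists u.
by exists 1 => _ [v Kv <-]; have := normr_dotv_le1 (Kb _ Kv) bx;
  rewrite ler_norml => /andP[].
Qed.

Lemma ge_lower K x u : convex_body K -> in_ball x -> K u ->
  lower K x <= dotv u x.
Proof.
move=> Kc bx Ku; rewrite lerNl -dotvN; apply: le_upper => //.
exact: in_ballN.
Qed.

Lemma upper_adherent K x e : convex_body K -> in_ball x -> 0 < e ->
  exists2 y, K y & upper K x - e < dotv y x.
Proof.
move=> [Kb [u Ku] _] bx e0.
have [|_ [y Ky <-] h] := @sup_adherent _ [set dotv u x | u in K] e e0.
  split; first by exists (dotv u x), u.
  by exists 1 => _ [v Kv <-]; have := normr_dotv_le1 (Kb _ Kv) bx;
    rewrite ler_norml => /andP[].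
by exists y.
Qed.

Lemma upper_le1 K x : convex_body K -> in_ball x -> upper K x <= 1.
Proof.
move=> [Kb [u Ku] _] bx; apply: ge_sup; first by exists (dotv u x), u.
by move=> _ [v Kv <-]; have := normr_dotv_le1 (Kb _ Kv) bx;
    rewrite ler_norml => /andP[].
Qed.

Lemma lower_geN1 K x : convex_body K -> in_ball x -> -1 <= lower K x.
Proof. by move=> Kc bx; rewrite lerN2 upper_le1//; exact: in_ballN. Qed.

(** The factor 160 makes the rounding loss [4 * d / mesh i] equal to [2 ^- i / 40]. Together with
    [W / 40] for a supremum that may not be attained, it fits into [W / 4 - W / 5 = W / 20]. *)
Definition mesh (i : nat) : nat := 160 * d * 2 ^ i.

(** The weight [2 ^- i] makes a cut of width about [2 ^- i] lower the sum in proportion to that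
    width. Widths below [2 ^- T] are not tracked; over [T] rounds they cost [O(T * 2 ^- T)]. *)
Definition potential (T : nat) K : R :=
  \sum_(i < T.+1) 2 ^- i * ln #|grid_nbhd (mesh i) K|%:R.

Lemma mesh_gt0 i : (0 < d)%N -> (0 < mesh i)%N.
Proof. by move=> d0; rewrite !muln_gt0 d0 expn_gt0. Qed.

Lemma potential_ge0 T K : 0 <= potential T K.
Proof.
apply: sumr_ge0 => i _; rewrite mulr_ge0// ?invr_ge0 ?exprn_ge0//.
case: #|_| => [|m]; first by rewrite ln0.
by rewrite ln_ge0// ler1n.
Qed.

Lemma le_ln_card_grid (n : nat) K K' : (0 < n)%N -> convex_body K ->
  K `<=` K' -> ln #|grid_nbhd n K|%:R <= ln #|grid_nbhd n K'|%:R :> R.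
Proof.
move=> n0 [Kb [u Ku] _] KK'.
have c0 := card_grid_nbhd_gt0 _ n0 _ _ Ku (Kb _ Ku).
have cc := subset_leq_card (sub_grid_nbhd n _ _ KK').
by rewrite ler_ln ?posrE ?ltr0n ?ler_nat// (leq_trans c0).
Qed.

Lemma le_potential T K K' : (0 < d)%N -> convex_body K -> K `<=` K' ->
  potential T K <= potential T K'.
Proof.
move=> d0 Kc KK'; apply: ler_sum => i _.
rewrite ler_pM2l ?invr_gt0 ?exprn_gt0//.
by apply: le_ln_card_grid => //; exact: mesh_gt0.
Qed.

(** From [N' <= 5 ^ d * (N - N')] follows [N' / N <= 1 - (1 + 5 ^ d)^-1]; the logarithm turns this
    ratio into a fixed decrease. *)
Lemma ln_card_grid_cut (i : nat) K x p W u : (0 < d)%N ->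
  convex_body K -> in_ball x -> K u -> dotv u x <= p ->
  upper K x - lower K x <= W -> p + W / 4 <= upper K x -> 2 ^- i < W ->
  ln #|grid_nbhd (mesh i) (cut_le K x p)|%:R + (1 + 5 ^+ d)^-1
    <= ln #|grid_nbhd (mesh i) K|%:R :> R.
Proof.
move=> d0 Kc bx Ku up hW hp iW.
have i0 : (0 : R) < 2 ^- i by rewrite invr_gt0 exprn_gt0.
have m0 := mesh_gt0 i d0.
have [|y Ky hy] := upper_adherent K x (W / 40) Kc bx; first by lra.
have [Kb _ Kcv] := Kc.
have yW k : K k -> dotv y x - dotv k x <= W.
  move=> Kk; have := ge_lower K x k Kc bx Kk; have := le_upper K x y Kc bx Ky.
  by lra.
have := card_grid_nbhd_cut _ m0 K x y p W Kb Kcv bx Ky yW.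
have -> : 4 * d%:R / (mesh i)%:R = 2 ^- i / 40 :> R.
  rewrite /mesh !natrM natrX.
  by field; rewrite pnatr_eq0 -lt0n d0 expf_neq0.
move=> /(_ ltac:(lra)).
have [K'b [v K'v] _] := convex_body_cut K x p u Kc Ku up.
have := card_grid_nbhd_gt0 _ m0 _ _ K'v (K'b _ K'v).
have := subset_leq_card
  (sub_grid_nbhd (mesh i) (cut_le K x p) K (@subIsetl _ _ _)).
move: #|grid_nbhd _ (cut_le _ _ _)| #|grid_nbhd _ K| => N' N NN' N'0 hN.
have N0 := leq_trans N'0 NN'.
have hN' : N'%:R <= 5 ^+ d * (N%:R - N'%:R) :> R.
  by rewrite -natrB// -natrX -natrM ler_nat.
have D0 : 0 < 1 + 5 ^+ d :> R by rewrite ltr_wpDr// exprn_ge0.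
have N0R : 0 < N%:R :> R by rewrite ltr0n.
have N'0R : 0 < N'%:R :> R by rewrite ltr0n.
(* ln z <= z - 1 at z = N' / N *)
have h : (1 + 5 ^+ d)^-1 <= 1 - N'%:R / N%:R :> R.
  have -> : 1 - N'%:R / N%:R = (N%:R - N'%:R) / N%:R :> R.
    by field; rewrite gt_eqF.
  by rewrite ler_pdivlMr// mulrC ler_pdivrMr//; lra.
have := @le_ln1Dx R (N'%:R / N%:R - 1).
rewrite [1 + _]addrC subrK ln_div ?posrE//.
have : 0 < N'%:R / N%:R :> R by rewrite divr_gt0.
by move=> z0 /(_ ltac:(lra)); lra.
Qed.

Lemma dyadic_scale (T : nat) W : 2 ^- T < W -> W <= 2 ->
  exists2 i : 'I_T.+1, 2 ^- i < W & W <= 2 * 2 ^- i.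
Proof.
elim: T => [|T IH] hT W2; first by exists ord0 => //=; rewrite expr0 invr1 mulr1.
have [/IH[]// i h1 h2|hW] := ltP (2 ^- T) W.
  by exists (widen_ord (leqnSn _) i).
exists ord_max => //=; apply: le_trans hW _.
by rewrite exprS invfM mulrA divff// mul1r.
Qed.

(** At the scale with [2 ^- i < W <= 2 * 2 ^- i] the term drops by at least [2 ^- i / (1 + 5 ^ d)],
    and no other term grows. The summand [2 ^- T] covers widths below the finest scale. *)
Lemma potential_cut (T : nat) K x p W u : (0 < d)%N ->
  convex_body K -> in_ball x -> K u -> dotv u x <= p ->
  upper K x - lower K x <= W -> p + W / 4 <= upper K x -> W <= 2 ->
  W <= 2 * (1 + 5 ^+ d) *
       (potential T K - potential T (cut_le K x p)) + 2 ^- T.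
Proof.
move=> d0 Kc bx Ku up hW hp W2.
have Kc' := convex_body_cut K x p u Kc Ku up.
have sK : cut_le K x p `<=` K by exact: subIsetl.
have T0 : (0 : R) < 2 ^- T by rewrite invr_gt0 exprn_gt0.
have D0 : 0 < 1 + 5 ^+ d :> R by rewrite ltr_wpDr// exprn_ge0.
have [WT|TW] := leP W (2 ^- T).
  rewrite ler_wpDl//; have := le_potential T _ _ d0 Kc' sK.
  by move=> *; rewrite mulr_ge0//; lra.
have [i i1 i2] := dyadic_scale _ _ TW W2.
have i0 : (0 : R) < 2 ^- i by rewrite invr_gt0 exprn_gt0.
have hcut := ln_card_grid_cut i K x p W u d0 Kc bx Ku up hW hp i1.
suff : 2 ^- i * (1 + 5 ^+ d)^-1 <=
    potential T K - potential T (cut_le K x p).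
  rewrite -ler_pdivlMr ?invr_gt0// invrK => h; nra.
rewrite /potential -sumrB (bigD1 i)//= -[leLHS]addr0 lerD//.
  by rewrite -mulrBr ler_pM2l//; lra.
apply: sumr_ge0 => j _; rewrite -mulrBr mulr_ge0 ?invr_ge0 ?exprn_ge0//.
by rewrite subr_ge0 le_ln_card_grid//; exact: mesh_gt0.
Qed.

Lemma sum_half_affine (a : R) (n : nat) :
  \sum_(i < n) 2 ^- i * (a + i%:R) = 2 * a + 2 - 2 ^- n * (2 * a + 2 * n%:R + 2).
Proof.
elim: n => [|n IH]; first by rewrite big_ord0 expr0 invr1; ring.
rewrite big_ord_recr/= IH exprS -natr1; field.
by rewrite expf_neq0.
Qed.

(** The full grid has [(2 * mesh i + 1) ^ d <= (321 * d * 2 ^ i) ^ d] points. The crude bounds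
    [ln 321 <= 321], [ln d <= d] and [ln 2 <= 1] leave an affine function of [i] to sum against
    [2 ^- i]. *)
Lemma potential_le (T : nat) K : (0 < d)%N ->
  potential T K <= d%:R * (644 + 2 * d%:R).
Proof.
move=> d0.
apply: (@le_trans _ _ (d%:R * \sum_(i < T.+1) 2 ^- i * ((321 + d%:R) + i%:R))).
  rewrite mulr_sumr; apply: ler_sum => i _; rewrite mulrCA.
  rewrite ler_pM2l ?invr_gt0 ?exprn_gt0//.
  have [->|c0] := posnP #|grid_nbhd (mesh i) K|.
    by rewrite ln0// mulr_ge0// !addr_ge0.
  apply: (@le_trans _ _ (ln ((321%N * d * 2 ^ i)%:R ^+ d))).
    rewrite ler_ln ?posrE ?exprn_gt0 ?ltr0n// ?muln_gt0 ?d0 ?expn_gt0//.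
    rewrite -natrX ler_nat.
    apply: leq_trans (max_card _) _.
    rewrite card_ffun !card_ord leq_exp2r//.
    have : (0 < d * 2 ^ i)%N by rewrite muln_gt0 d0 expn_gt0.
    rewrite /mesh -!mulnA; lia.
  rewrite lnXn ?ltr0n ?muln_gt0 ?d0 ?expn_gt0// mulr_natl ler_pMn2r//.
  rewrite natrM lnM ?posrE ?ltr0n ?muln_gt0 ?d0 ?expn_gt0//.
  rewrite natrM lnM ?posrE ?ltr0n//.
  rewrite natrX lnXn// -(mulr_natr (ln 2)).
  have h1 := ltW (ln_sublinear (ltr0n R 321 : 0 < 321%N%:R)).
  have h2 : ln d%:R <= d%:R :> R by rewrite ltW// ln_sublinear ?ltr0n.
  have h3 : ln 2 <= 1 :> R.
    by have := @le_ln1Dx R 1; rewrite -[1 + 1]/(2:R); apply; lra.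
  have : ln 2 * i%:R <= i%:R :> R by rewrite ler_piMl.
  by lra.
rewrite sum_half_affine ler_pM2l ?ltr0n//.
have : 0 <= 2 ^- T.+1 * (2 * (321 + d%:R) + 2 * T.+1%:R + 2) :> R.
  by rewrite mulr_ge0// ?invr_ge0 ?exprn_ge0// !addr_ge0// mulr_ge0// addr_ge0.
by lra.
Qed.

End Potential.

(** * One round *)

(** The [floor c] integers from [e = ceil a] on lie in the interval, and the last of them is below
    [m]. This converts the length of a price interval into a number of grid prices. *)
Lemma card_ord_itv {R : realType} (m : nat) (a c : R) : 0 <= a -> a + c <= m%:R ->
  c - 1 <= (\sum_(j < m) ((a <= j%:R <= a + c)%R : nat))%N%:R.
Proof.
move=> a0 acm; have [c1|c1] := ltP c 1.
  by apply: (@le_trans _ _ 0); [lra|exact: ler0n].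
have [e /andP[e1 e2]] : exists e : nat, a <= e%:R < a + 1.
  have /andP[h1 h2] := truncn_itv a0; have [h|h] := leP a (Num.truncn a)%:R.
    by exists (Num.truncn a); lra.
  by exists (Num.truncn a).+1; rewrite -natr1 in h2 *; lra.
have /andP[q1 q2] : (Num.truncn c)%:R <= c < (Num.truncn c).+1%:R.
  by apply: truncn_itv; lra.
move: (Num.truncn c) q1 q2 => q q1; rewrite -natr1 => q2.
have eqm : (e + q <= m)%N.
  have : (e + q)%:R < m.+1%:R :> R by rewrite natrD -natr1; lra.
  by rewrite ltr_nat ltnS.
apply: (@le_trans _ _ q%:R); first by lra.
rewrite ler_nat -(big_mkord xpredT (fun j => ((a <= j%:R <= a + c)%R : nat))).
rewrite (big_cat_nat (n := e))//=; last by lia.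
rewrite (big_cat_nat (n := (e + q)%N) (m := e))//=; last by lia.
rewrite addnCA -[leqLHS]addn0 leq_add//.
rewrite big_nat (eq_bigr (fun=> 1%N)); last first.
  move=> j /andP[ej jq]; suff -> : a <= j%:R <= a + c by [].
  have : e%:R <= j%:R :> R by rewrite ler_nat.
  have : j.+1%:R <= (e + q)%:R :> R by rewrite ler_nat.
  by rewrite -natr1 natrD; lra.
by rewrite -big_nat sum_nat_const_nat muln1 addKn.
Qed.

Section Learner.
Context {R : realType} {d : nat}.
Implicit Types (s b x : 'rV[R]_d) (K : set 'rV[R]_d) (p : R)
  (S : set 'rV[R]_d * set 'rV[R]_d).

Definition width S x : R :=
  Num.max (upper S.1 x - lower S.1 x) (upper S.2 x - lower S.2 x).

(* Posting [lower S.2 x] is always acceptable to the buyer, so the feedback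
   bit is then about the seller alone; dually for [upper S.1 x]. *)
Definition probe_seller S x : bool :=
  lower S.1 x + width S x / 4 <= lower S.2 x.
Definition probe_buyer S x : bool :=
  upper S.1 x + width S x / 4 <= upper S.2 x.

Definition price S x (theta : R) : R :=
  if probe_seller S x then lower S.2 x
  else if probe_buyer S x then upper S.1 x
  else lower S.1 x + theta * (upper S.2 x - lower S.1 x).

Definition cut_ge K x p := cut_le K (- x) (- p).

(** A refused random price does not reveal who refused, so it cuts nothing; a trade at it informs on
    both sides. *)
Definition update S x p (traded : bool) :=
  if probe_seller S x then (if traded then S else (cut_ge S.1 x p, S.2))
  else if probe_buyer S x then (if traded then S else (S.1, cut_le S.2 x p))
  else if traded then (cut_le S.1 x p, cut_ge S.2 x p) else S.

Definition consistent s b S :=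
  [/\ convex_body S.1, convex_body S.2, S.1 s & S.2 b].

Definition potential2 (T : nat) S : R := potential T S.1 + potential T S.2.

Definition loss s b x p : R :=
  Num.max 0 (dotv b x - dotv s x) - gft s b x (p, p).

Lemma cut_leP K x p u : convex_body K -> K u -> dotv u x <= p ->
  convex_body (cut_le K x p) /\ cut_le K x p u.
Proof. by move=> Kc Ku up; split; [exact: convex_body_cut up|]. Qed.

Lemma cut_geP K x p u : convex_body K -> K u -> p <= dotv u x ->
  convex_body (cut_ge K x p) /\ cut_ge K x p u.
Proof. by move=> Kc Ku up; apply: cut_leP => //; rewrite dotvN lerN2. Qed.

Lemma potential_cut_ge (T : nat) K x p W u : (0 < d)%N ->
  convex_body K -> in_ball x -> K u -> p <= dotv u x ->
  upper K x - lower K x <= W -> lower K x + W / 4 <= p -> W <= 2 ->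
  W <= 2 * (1 + 5 ^+ d) * (potential T K - potential T (cut_ge K x p)) + 2 ^- T.
Proof.
move=> d0 Kc bx Ku pu hW hp W2.
apply: (potential_cut T K (- x) (- p) W u) => //.
- exact: in_ballN.
- by rewrite dotvN lerN2.
- by move: hW; rewrite /lower !opprK; lra.
- by move: hp; rewrite /lower; lra.
Qed.

Section Round.
Variables (s b x : 'rV[R]_d) (S : set 'rV[R]_d * set 'rV[R]_d) (T : nat).
Hypotheses (d0 : (0 < d)%N) (bx : in_ball x) (cS : consistent s b S).

Local Notation ls := (lower S.1 x).
Local Notation us := (upper S.1 x).
Local Notation lb := (lower S.2 x).
Local Notation ub := (upper S.2 x).
Local Notation W := (width S x).
Local Notation next theta := (update S x (price S x theta)
  (trade s b x (price S x theta, price S x theta))).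

Let s_itv : ls <= dotv s x <= us.
Proof. by case: cS => *; rewrite ge_lower// le_upper. Qed.

Let b_itv : lb <= dotv b x <= ub.
Proof. by case: cS => *; rewrite ge_lower// le_upper. Qed.

Let s_W : us - ls <= W. Proof. by rewrite le_max lexx. Qed.
Let b_W : ub - lb <= W. Proof. by rewrite le_max lexx orbT. Qed.

Let W_cases : W = us - ls \/ W = ub - lb.
Proof. by rewrite /width; case: leP => _; [right|left]. Qed.

Let ls_ge : -1 <= ls. Proof. by case: cS => *; exact: lower_geN1. Qed.
Let ub_le : ub <= 1. Proof. by case: cS => *; exact: upper_le1. Qed.

Let W_le2 : W <= 2.
Proof.
case: cS => cs cb _ _; have := upper_le1 S.1 x cs bx.
have := lower_geN1 S.2 x cb bx; move: ls_ge ub_le.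
by case: W_cases => ->; lra.
Qed.

Let W_ge0 : 0 <= W. Proof. by move: s_itv s_W; lra. Qed.

Lemma update_consistent theta : consistent s b (next theta).
Proof.
case: cS => cs cb Ss Sb; rewrite /update /price /trade.
case: (boolP (probe_seller S x)) => [_|_] /=;
  [|case: (boolP (probe_buyer S x)) => [_|_] /=].
- case: ifP => //; move: b_itv => /andP[-> _]; rewrite andbT => /negbT.
  rewrite -ltNge => /ltW h; split => //=.
    exact: (cut_geP _ _ _ s cs Ss h).1.
  exact: (cut_geP _ _ _ s cs Ss h).2.
- case: ifP => //; move: s_itv => /andP[_ ->] /= /negbT.
  rewrite -ltNge => /ltW h; split => //=.
    exact: (cut_leP _ _ _ b cb Sb h).1.
- case: ifP => // /andP[/= h1 h2]; split => /=.
  + exact: (cut_leP _ _ _ s cs Ss h1).1.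
  + exact: (cut_geP _ _ _ b cb Sb h2).1.
  + exact: (cut_leP _ _ _ s cs Ss h1).2.
  + exact: (cut_geP _ _ _ b cb Sb h2).2.
Qed.

(** With equal prices a trade forces [dotv s x <= p <= dotv b x], so the whole positive part is
    gained. *)
Lemma lossE p : loss s b x p =
  if trade s b x (p, p) then 0 else Num.max 0 (dotv b x - dotv s x).
Proof.
rewrite /loss /gft; case: ifP => [/andP[/= h1 h2]|_]; last by rewrite subr0.
by rewrite max_r ?subrr// subr_ge0 (le_trans h1).
Qed.

Local Notation D := (2 * (1 + 5 ^+ d) : R).

Let D_ge0 : 0 <= D.
Proof. by rewrite mulr_ge0// addr_ge0// exprn_ge0. Qed.

Let T_ge0 : 0 <= 2 ^- T :> R.
Proof. by rewrite invr_ge0 exprn_ge0. Qed.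

(** A refused probe confines both valuations to one interval of length at most [W]: for the seller
    probe, [lb < dotv s x] and [dotv b x <= ub]. The cut pays for that [W]. The factor 2 on the
    potential comes from [loss_random]. *)
Lemma loss_probe theta : probe_seller S x || probe_buyer S x ->
  loss s b x (price S x theta) + 2 * D * potential2 T (next theta) <=
  2 * D * potential2 T S + 2 * 2 ^- T.
Proof.
move=> pr; rewrite lossE; case: cS => cs cb Ss Sb.
move: pr; rewrite /update /price /trade.
case: (boolP (probe_seller S x)) => [A _|_] /=;
  [|case: (boolP (probe_buyer S x)) => [B _|//] /=].
- case: ifP; first by move=> _; move: T_ge0; lra.
  move: b_itv => /andP[-> bub]; rewrite andbT => /negbT.
  rewrite -ltNge => h.
  have := potential_cut_ge T _ _ _ _ _ d0 cs bx Ss (ltW h) s_W A W_le2.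
  have : Num.max 0 (dotv b x - dotv s x) <= W.
    by rewrite ge_max W_ge0/=; move: s_W b_W; lra.
  by rewrite /potential2 /=; move: W_ge0 T_ge0; lra.
- case: ifP; first by move=> _; move: T_ge0; lra.
  move: s_itv => /andP[sls ->] /= /negbT.
  rewrite -ltNge => h.
  have := potential_cut T _ _ _ _ _ d0 cb bx Sb (ltW h) b_W B W_le2.
  have : Num.max 0 (dotv b x - dotv s x) <= W.
    by rewrite ge_max W_ge0/=; move: s_W b_W; lra.
  by rewrite /potential2 /=; move: W_ge0 T_ge0; lra.
Qed.

(** A trade at a random price releases [2 * W] of potential, up to [2 * 2 ^- T]. This credit offsets
    the gains missed at the other prices. *)
Lemma loss_random theta : ~~ (probe_seller S x || probe_buyer S x) ->
  loss s b x (price S x theta) + 2 * D * potential2 T (next theta) <=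
  2 * D * potential2 T S + Num.max 0 (dotv b x - dotv s x) -
  (trade s b x (price S x theta, price S x theta))%:R * (2 * W - 2 * 2 ^- T).
Proof.
rewrite negb_or => /andP[/negbTE nA /negbTE nB].
rewrite lossE /update nA nB; case: ifP => [tr|_]; last by rewrite mul0r; lra.
have d_ge0 : 0 <= Num.max 0 (dotv b x - dotv s x) by rewrite le_max lexx.
case: cS => cs cb Ss Sb; case/andP: tr; move: (price S x theta) => p /= h1 h2.
suff : W <= D * (potential2 T S - potential2 T (cut_le S.1 x p, cut_ge S.2 x p))
         + 2 ^- T.
  rewrite mul1r => h; move: (potential2 _ _) (potential2 _ _) h D_ge0 => *; nra.
rewrite /potential2/=.
have m1 := le_potential T _ _ d0 (cut_leP _ _ _ s cs Ss h1).1 (@subIsetl _ _ _).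
have m2 := le_potential T _ _ d0 (cut_geP _ _ _ b cb Sb h2).1 (@subIsetl _ _ _).
have [c1|c1] := leP (p + W / 4) us.
  have := potential_cut T _ _ _ _ _ d0 cs bx Ss h1 s_W c1 W_le2.
  by move=> h; apply: le_trans h _; rewrite lerD2r ler_wpM2l//; lra.
have [c2|c2] := leP (lb + W / 4) p.
  have := potential_cut_ge T _ _ _ _ _ d0 cb bx Sb h2 b_W c2 W_le2.
  by move=> h; apply: le_trans h _; rewrite lerD2r ler_wpM2l//; lra.
(* If both cuts were shallower than [W / 4], then [us < lb + W / 2]. The failed probes would give
   [us < ls + 3 * W / 4] and [ub < lb + 3 * W / 4], so neither width could be [W]. *)
move/negbT: nA; move/negbT: nB; rewrite /probe_seller /probe_buyer -!ltNge.
by move: W_ge0; case: W_cases => WE; lra.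
Qed.

(** Trading prices fill a fraction [gain / (ub - ls)] of the grid, up to one point. Failed probes
    give [ub - ls <= 2 * W], and the lost point costs [ub - ls <= 2]. *)
Lemma gain_le_trades (m : nat) : (0 < m)%N ->
  ~~ (probe_seller S x || probe_buyer S x) ->
  m%:R * Num.max 0 (dotv b x - dotv s x) <=
  2 * W * (\sum_(j < m) (trade s b x (price S x (j%:R / m%:R)%R,
                                      price S x (j%:R / m%:R)%R) : nat))%N%:R + 2.
Proof.
move=> m0; rewrite negb_or => /andP[/negbTE nA /negbTE nB].
set N := (X in _ * X%:R).
have N0 : 0 <= N%:R :> R by [].
have [sb|sb] := leP (dotv b x) (dotv s x).
  rewrite max_l ?mulr0; last by lra.
  by rewrite addr_ge0// !mulr_ge0.
rewrite max_r; last by lra.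
case/andP: s_itv => s1 s2; case/andP: b_itv => b1 b2.
have mR : 0 < m%:R :> R by rewrite ltr0n.
have L0 : 0 < ub - ls by lra.
have L2 : ub - ls <= 2 by move: ls_ge ub_le; lra.
have L1 : ub - ls <= 2 * W.
  by move/negbT: nB; rewrite /probe_buyer -ltNge; move: s_W W_ge0; lra.
pose a := (dotv s x - ls) * m%:R / (ub - ls).
pose c := (dotv b x - dotv s x) * m%:R / (ub - ls).
have acE : a + c = (dotv b x - ls) * m%:R / (ub - ls).
  by rewrite /a /c; field; rewrite gt_eqF.
have a0 : 0 <= a by rewrite /a divr_ge0 ?mulr_ge0//; lra.
have acm : a + c <= m%:R.
  by rewrite acE ler_pdivrMr// [leRHS]mulrC ler_pM2r//; lra.
have := card_ord_itv m a c a0 acm.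
have -> : (\sum_(j < m) ((a <= j%:R <= a + c)%R : nat))%N = N.
  apply: eq_bigr => j _; congr (nat_of_bool _).
  rewrite /trade /price nA nB/= acE /a ler_pdivrMr// ler_pdivlMr//.
  have -> : j%:R / m%:R * (ub - ls) = j%:R * (ub - ls) / m%:R by rewrite mulrAC.
  by rewrite -lerBlDl ler_pdivlMr// -lerBrDl ler_pdivrMr.
rewrite lerBlDr ler_pdivrMr// => h.
have h2 : (ub - ls) * N%:R <= 2 * W * N%:R by rewrite ler_wpM2r.
by move: h; rewrite mulrC mulrDl mul1r; nra.
Qed.

(** On average over the [m] prices, the loss is paid by the potential, up to [2 * 2 ^- T] and a
    discretisation error [2 / m]. *)
Lemma round_bound (m : nat) : (0 < m)%N ->
  \sum_(j < m) (loss s b x (price S x (j%:R / m%:R)) +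
                2 * D * potential2 T (next (j%:R / m%:R))) <=
  m%:R * (2 * D * potential2 T S + 2 * 2 ^- T) + 2.
Proof.
move=> m0; have sumC (c : R) : \sum_(j < m) c = m%:R * c.
  by rewrite sumr_const card_ord mulr_natl.
have [pr|pr] := boolP (probe_seller S x || probe_buyer S x).
  rewrite -sumC ler_wpDr//; apply: ler_sum => j _; exact: loss_probe.
apply: le_trans (ler_sum _ (fun j _ => loss_random _ pr)) _.
rewrite big_split/= sumC sumrN -mulr_suml -natr_sum.
have := gain_le_trades m m0 pr.
set N := (\sum_(_ < _) _)%N => h.
have Nm : N%:R <= m%:R :> R.
  rewrite ler_nat -[leqRHS]card_ord -sum1_card; apply: leq_sum => j _.
  exact: leq_b1.
have : 0 <= (m%:R - N%:R) * 2 ^- T :> R by rewrite mulr_ge0// subr_ge0.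
by rewrite mulrDr; lra.
Qed.

End Round.
End Learner.

(** * Independent digits of a uniform seed *)

Section Seed.
Context {R : realType}.

Definition cell (M k : nat) : set R := `[k%:R / M%:R, k.+1%:R / M%:R[.

Lemma cellP {M k : nat} {w : R} : (0 < M)%N ->
  cell M k w <-> k%:R <= w * M%:R < k.+1%:R.
Proof.
move=> M0; have MR : 0 < M%:R :> R by rewrite ltr0n.
by rewrite /cell /= in_itv/= ler_pdivrMr// ltr_pdivlMr.
Qed.

Lemma cell_truncn {M : nat} {w : R} : (0 < M)%N -> 0 <= w < 1 ->
  (Num.truncn (w * M%:R) < M)%N /\ cell M (Num.truncn (w * M%:R)) w.
Proof.
move=> M0 /andP[w0 w1]; have MR : 0 < M%:R :> R by rewrite ltr0n.
have wM : 0 <= w * M%:R by rewrite mulr_ge0.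
split; last by apply/cellP => //; exact: truncn_itv.
by rewrite truncn_lt_nat// -[ltRHS]mul1r ltr_pM2r.
Qed.

Lemma cell_unit {M k : nat} {w : R} : (k < M)%N -> cell M k w -> 0 <= w < 1.
Proof.
move=> kM; have M0 : (0 < M)%N by apply: leq_trans kM.
have MR : 0 < M%:R :> R by rewrite ltr0n.
move=> /(cellP M0)/andP[h1 h2]; apply/andP; split.
  by rewrite -(pmulr_lge0 _ MR) (le_trans _ h1).
by rewrite -(ltr_pM2r MR) mul1r (lt_le_trans h2)// ler_nat.
Qed.

Lemma trivIset_cell (M : nat) (D : set nat) : (0 < M)%N ->
  trivIset D (cell M).
Proof.
move=> M0 i j _ _ [w [/(cellP M0) wi /(cellP M0) wj]].
by rewrite -(truncn_def wi) -(truncn_def wj).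
Qed.

Lemma bigcup_cell (M : nat) : (0 < M)%N ->
  `[0, 1[ = \big[setU/set0]_(k <- iota 0 M) cell M k.
Proof.
move=> M0; rewrite -bigcup_seq; apply/seteqP; split => w.
  rewrite /= in_itv/= => /(cell_truncn M0)[h1 h2].
  by exists (Num.truncn (w * M%:R)) => //=; rewrite mem_iota.
by move=> [k /=]; rewrite mem_iota in_itv/= add0n => kM; exact: cell_unit.
Qed.

(** Reduces expectations over the seed to finite averages. The constant [c] sits on a null set and
    serves measurability on the whole line. *)
Lemma uniform_step (M : nat) (f : R -> R) (g : nat -> R) (c : R) : (0 < M)%N ->
  (forall w, 0 <= f w) ->
  (forall k w, (k < M)%N -> cell M k w -> f w = g k) ->
  (forall w, ~~ (0 <= w < 1) -> f w = c) ->
  measurable_fun setT f /\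
  (\int[uniform_prob (@ltr01 R)]_w (f w)%:E =
    (M%:R^-1 * \sum_(k < M) g k)%:E)%E.
Proof.
move=> M0 f0 fg fc.
have mcell k : measurable (cell M k) by exact: measurable_itv.
have mf : measurable_fun setT f.
  rewrite (_ : f = fun w => (\sum_(k <- iota 0 M) g k * \1_(cell M k) w) +
      c * \1_(~` `[0, 1[) w); last first.
    apply/funext => w; have [w01|w01] := boolP (0 <= w < 1).
      have [h1 h2] := cell_truncn M0 w01.
      rewrite (bigD1_seq (Num.truncn (w * M%:R))) ?mem_iota ?iota_uniq//=.
      rewrite indicE mem_set// mulr1 (fg _ _ h1 h2) big1 ?addr0; last first.
        move=> k kn; rewrite indicE memNset ?mulr0// => /(cellP M0)/truncn_def E.
        by rewrite E eqxx in kn.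
      by rewrite indicE memNset ?mulr0 ?addr0.
    rewrite big1_seq ?add0r; last first.
      move=> k; rewrite /= mem_iota add0n => kM.
      rewrite indicE memNset ?mulr0// => /(cell_unit kM).
      by apply/negP.
    by rewrite indicE mem_set ?mulr1 ?fc//= in_itv/=; exact/negP.
  apply: measurable_funD.
    by apply: measurable_sum => k; exact: measurable_funM.
  by apply: measurable_funM => //; apply: measurable_indic; exact: measurableC.
split=> //.
have mfE : measurable_fun setT (EFin \o f) by exact/measurable_EFinP.
rewrite integral_uniform//.
rewrite subr0 invr1 mul1e -integral_itv_bndo_bndc; last first.
  exact: measurable_funS mfE.
rewrite (bigcup_cell M M0) ge0_integral_bigsetU//=; last 4 first.
- exact: iota_uniq.
- exact: trivIset_cell.
- exact: measurable_funS mfE.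
- by move=> *; rewrite lee_fin.
rewrite mulr_sumr -sumEFin -(big_mkord xpredT (fun k => (M%:R^-1 * g k)%:E)).
rewrite /index_iota subn0; apply: eq_big_seq => k.
rewrite mem_iota add0n => /= kM.
rewrite (eq_integral (cst (g k)%:E)); last first.
  by move=> w; rewrite inE => hw; rewrite (fg k)//; exact/set_mem.
rewrite integral_cst; last exact: mcell.
rewrite /= /cell lebesgue_measure_itv/= lte_fin.
have MR : 0 < M%:R :> R by rewrite ltr0n.
rewrite ltr_pM2r ?invr_gt0// ltr_nat ltnSn -EFinB -EFinM; congr EFin.
by rewrite -natr1; field; rewrite gt_eqF.
Qed.

(** The number of outcomes of the first [t] draws. Round [t] draws among [2 ^ t] prices, which makes
    the errors [2 / 2 ^ t] summable. *)
Fixpoint nodes (t : nat) : nat := if t is t'.+1 then nodes t' * 2 ^ t' else 1.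

Lemma nodes_gt0 t : (0 < nodes t)%N.
Proof. by elim: t => //= t IH; rewrite muln_gt0 IH expn_gt0. Qed.

(* The seed [w], uniform in [0, 1[, encodes a sequence of independent digits:
   [digit t w] is uniform in [0, 2 ^ t[ and [node t w] packs the first [t]. *)
Definition node (t : nat) (w : R) : nat :=
  if 0 <= w < 1 then Num.truncn (w * (nodes t)%:R) else 0.

Definition digit (t : nat) (w : R) : nat := (node t.+1 w %% 2 ^ t)%N.

Lemma node_div t w : node t w = (node t.+1 w %/ 2 ^ t)%N.
Proof.
rewrite /node; case: ifP => [/andP[w0 _]|_]; last by rewrite div0n.
have e0 : (0 < 2 ^ t)%N by rewrite expn_gt0.
have eR : 0 < (2 ^ t)%:R :> R by rewrite ltr0n.
apply: truncn_def => /=; rewrite natrM mulrA.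
have : 0 <= w * (nodes t)%:R * (2 ^ t)%:R by rewrite !mulr_ge0.
move=> /truncn_itv; move: (Num.truncn _) => k /andP[h1 h2].
apply/andP; split; rewrite -(ler_pM2r eR, ltr_pM2r eR) -natrM.
  by apply: le_trans h1; rewrite ler_nat leq_trunc_div.
by apply: lt_le_trans h2 _; rewrite ler_nat ltn_ceil.
Qed.

Lemma eq_node {t w w'} : node t w = node t w' ->
  forall i, (i < t)%N -> digit i w = digit i w'.
Proof.
elim: t => // t IH e i; rewrite ltnS leq_eqVlt => /predU1P[->|it].
  by rewrite /digit e.
by apply: IH => //; rewrite (node_div t w) e -node_div.
Qed.

Lemma node_cell t k w : (k < nodes t)%N -> cell (nodes t) k w -> node t w = k.
Proof.
move=> kt hw; rewrite /node (cell_unit kt hw).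
by apply: truncn_def; exact/cellP/hw/nodes_gt0.
Qed.

(** The left end of a cell, used as the representative seed for all seeds sharing its first [t]
    digits. *)
Definition node_pt (t k : nat) : R := k%:R / (nodes t)%:R.

Lemma node_ptK t k : (k < nodes t)%N -> node t (node_pt t k) = k.
Proof.
move=> kt; apply: node_cell => //; apply/cellP; first exact: nodes_gt0.
have n0 : (nodes t)%:R != 0 :> R by rewrite pnatr_eq0 -lt0n nodes_gt0.
by rewrite /node_pt divfK// lexx ltr_nat ltnSn.
Qed.

Lemma digit_node_pt_last t k j : (k < nodes t)%N -> (j < 2 ^ t)%N ->
  digit t (node_pt t.+1 (k * 2 ^ t + j)) = j.
Proof.
move=> kt jt; rewrite /digit node_ptK.
  by rewrite modnMDl modn_small.
by rewrite /= (leq_trans (n := (k.+1 * 2 ^ t)%N))// ?leq_mul2r ?kt ?orbT//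
  mulSn addnC ltn_add2r.
Qed.

Lemma digit_node_pt_init t k j i : (k < nodes t)%N -> (j < 2 ^ t)%N ->
  (i < t)%N -> digit i (node_pt t.+1 (k * 2 ^ t + j)) = digit i (node_pt t k).
Proof.
move=> kt jt; apply: eq_node; rewrite node_div !node_ptK//.
  by rewrite divnMDl ?expn_gt0// divn_small// addn0.
by rewrite /= (leq_trans (n := (k.+1 * 2 ^ t)%N))// ?leq_mul2r ?kt ?orbT//
  mulSn addnC ltn_add2r.
Qed.

Lemma sum_nodes t (F : nat -> R) :
  \sum_(k < nodes t.+1) F k =
  \sum_(k < nodes t) \sum_(j < 2 ^ t) F (k * 2 ^ t + j)%N.
Proof.
rewrite -(big_mkord xpredT F) /= big_nat_mul big_mkord; apply: eq_bigr => k _.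
rewrite -{1}[(k * 2 ^ t)%N]add0n big_addn mulSn addnK big_mkord.
by apply: eq_bigr => j _; rewrite addnC.
Qed.

End Seed.

(** * The learner and its regret *)

(** Bernoulli's inequality for [(1 + 1/5) ^ n]; it absorbs the extra factor [d] of the
    [d ^ 2 * 5 ^ d] bound. *)
Lemma exp5_linear_le {R : realType} (n : nat) :
  5 ^+ n * (1 + n%:R / 5) <= 6 ^+ n :> R.
Proof.
elim: n => [|n IH]; first by rewrite !expr0; lra.
have : 0 <= 5 ^+ n * n%:R :> R by rewrite mulr_ge0// exprn_ge0.
by rewrite !exprS -(natr1 n); lra.
Qed.

Section Policy.
Context {R : realType} {d : nat}.

Definition theta (w : R) (t : nat) : R := (digit t w)%:R / (2 ^ t)%:R.

(** A policy sees only the history, so the candidate sets are rebuilt by replaying it; the counter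
    selects the digit of the seed for each round. *)
Definition run (w : R) (h : seq ('rV[R]_d * bool)) :=
  foldl (fun S o => (S.1.+1, update S.2 o.1 (price S.2 o.1 (theta w S.1)) o.2))
    (0, (@in_ball R d, @in_ball R d)) h.

Definition learner : policy R d R := fun w h x =>
  let p := price (run w h).2 x (theta w (run w h).1) in (p, p).

Section Instance.
Variables (s b : 'rV[R]_d) (x : nat -> 'rV[R]_d).
Hypotheses (bs : in_ball s) (bb : in_ball b) (bx : forall k, in_ball (x k)).

Let hist w t := history learner w s b x t.
Definition state w t := (run w (hist w t)).2.
Let post w t := price (state w t) (x t) (theta w t).

Let run1 w t : (run w (hist w t)).1 = t.
Proof. by elim: t => //= t IH; rewrite /run foldl_rcons/= -/(run _ _) IH. Qed.

Lemma pricesE w t : prices learner w s b x t = (post w t, post w t).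
Proof. by rewrite /prices /learner run1. Qed.

Lemma stateS w t :
  state w t.+1 = update (state w t) (x t) (post w t)
                   (trade s b (x t) (post w t, post w t)).
Proof.
have := pricesE w t; rewrite /prices => E.
by rewrite /state /= /run foldl_rcons/= -/(run _ _) E run1.
Qed.

Lemma eq_state t w w' : (forall i, (i < t)%N -> digit i w = digit i w') ->
  state w t = state w' t.
Proof.
elim: t => // t IH e; rewrite !stateS /post /theta e// IH// => i it.
by apply: e; exact: ltnW.
Qed.

Lemma state_consistent w t : consistent s b (state w t).
Proof.
elim: t => [|t IH]; first by split=> //; exact: convex_body_ball.
by rewrite stateS; exact: update_consistent.
Qed.

Let regret w t := realized_regret learner w s b x t.

Lemma regretE w t : regret w t = \sum_(i < t) loss s b (x i) (post w i).
Proof.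
rewrite /regret /realized_regret -sumrB; apply: eq_bigr => i _.
by rewrite pricesE.
Qed.

Lemma regret_ge0 w t : 0 <= regret w t.
Proof.
rewrite regretE; apply: sumr_ge0 => i _; rewrite lossE.
by case: ifP => // _; rewrite le_max lexx.
Qed.

Lemma eq_regret t w w' : (forall i, (i < t)%N -> digit i w = digit i w') ->
  regret w t = regret w' t.
Proof.
move=> e; rewrite !regretE; apply: eq_bigr => i _; rewrite /post /theta e//.
by rewrite (@eq_state i w w')// => j ji; rewrite e// (ltn_trans ji).
Qed.

Hypothesis d0 : (0 < d)%N.

Local Notation D := (2 * (1 + 5 ^+ d) : R).

(** Expected regret plus potential grows per round only by the errors of [round_bound];
    [4 * (1 - 2 ^- t)] is the sum of [2 / 2 ^ i] over [i < t]. *)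
Lemma sum_regret T t :
  \sum_(k < nodes t) (regret (node_pt t k) t +
                      2 * D * potential2 T (state (node_pt t k) t)) <=
  (nodes t)%:R * (2 * D * potential2 T (@in_ball R d, @in_ball R d) +
                  t%:R * (2 * 2 ^- T) + 4 * (1 - 2 ^- t)).
Proof.
elim: t => [|t IH].
  by rewrite big_ord1 regretE big_ord0 expr0 invr1 /state/= /run/=; lra.
rewrite (sum_nodes t (fun k => regret (node_pt t.+1 k) t.+1 +
  2 * D * potential2 T (state (node_pt t.+1 k) t.+1))).
have e0 : 0 < (2 ^ t)%:R :> R by rewrite ltr0n expn_gt0.
pose F k := regret (node_pt t k) t + 2 * D * potential2 T (state (node_pt t k) t).
apply: (@le_trans _ _ (\sum_(k < nodes t) ((2 ^ t)%:R * (F k + 2 * 2 ^- T) + 2))).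
  apply: ler_sum => k _.
  pose w := node_pt t k : R; pose S := state w t.
  have := @round_bound R d s b (x t) S T d0 (bx t) (state_consistent w t)
    (2 ^ t)%N ltac:(by rewrite expn_gt0).
  move=> h; have -> : (2 ^ t)%:R * (F k + 2 * 2 ^- T) + 2 =
      (2 ^ t)%:R * (2 * D * potential2 T S + 2 * 2 ^- T) + 2 +
      \sum_(j < 2 ^ t) regret w t.
    by rewrite sumr_const card_ord -mulr_natl /F -/w -/S; ring.
  apply: le_trans (lerD h (lexx _)); rewrite -big_split/=.
  apply: ler_sum => j _; set w' := node_pt t.+1 _.
  (* The first [t] digits of [w'] are those of [w], so the state is the same, while the last digit
     [j] runs over all prices of the round. *)
  have kn := ltn_ord k; have jn := ltn_ord j.
  have ei i : (i < t)%N -> digit i w' = digit i w.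
    exact: digit_node_pt_init.
  have et : theta w' t = j%:R / (2 ^ t)%:R.
    by rewrite /theta digit_node_pt_last.
  rewrite stateS /post et (eq_state _ _ _ ei) -/S.
  rewrite regretE big_ord_recr/= -regretE (eq_regret _ _ _ ei) /post et.
  by rewrite (eq_state _ _ _ ei) -/S; lra.
have sumC (c : R) : \sum_(k < nodes t) c = (nodes t)%:R * c.
  by rewrite sumr_const card_ord mulr_natl.
rewrite big_split/= -mulr_sumr sumC big_split/= sumC natrM natrX in e0 *.
rewrite /F -natr1 exprS invfM.
have e1 : 2 ^+ t * 2 ^- t = 1 :> R by rewrite divff// gt_eqF.
have N0 : 0 <= (nodes t)%:R :> R by [].
rewrite -(ler_pM2l e0) in IH.
set A := 2 ^+ t in e0 e1 IH *; set A' := A^-1 in e1 IH *.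
move: IH; move: (\sum_(_ < _) _) => Sm IH.
set N := (nodes t)%:R in N0 IH *; set t' := 2 ^- T in IH *.
rewrite 2!mulrDr; apply: le_trans (lerD (lerD IH (lexx _)) (lexx _)) _.
rewrite le_eqVlt; apply/orP; left; apply/eqP.
rewrite [in RHS]mulrDr; set P := potential2 _ _.
have -> : 4 * (1 - 2^-1 * A') = 4 * (1 - A') + 2 * A' by lra.
transitivity (A * N * (2 * D * P + t%:R * (2 * t') + 4 * (1 - A')) + 
   A * (2 * t') * N + (A * A') * 2 * N); first by rewrite e1; ring.
ring.
Qed.

Lemma regret_bound T :
  measurable_fun setT (fun w => regret w T) /\
  (\int[uniform_prob (@ltr01 R)]_w (regret w T)%:E <=
    (16 * 645 * (d%:R * 6 ^+ d))%:E)%E.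
Proof.
(* Outside [[0, 1[] every node is 0 by convention, so the regret is constant there; [-1] is a sample
   point. *)
have [] := @uniform_step R (nodes T) (fun w => regret w T)
  (fun k => regret (node_pt T k) T) (regret (-1) T) (nodes_gt0 T).
- by move=> w; exact: regret_ge0.
- move=> k w kT hw; apply: eq_regret; apply: eq_node.
  by rewrite node_ptK// (node_cell T k).
- move=> w hw; apply: eq_regret; apply: eq_node.
  by rewrite /node (negbTE hw) ifF//; lra.
move=> mf ->; split=> //; rewrite lee_fin.
have n0 : 0 < (nodes T)%:R :> R by rewrite ltr0n nodes_gt0.
rewrite mulrC ler_pdivrMr//.
have D0 : 0 <= D by rewrite mulr_ge0// addr_ge0// exprn_ge0.
apply: (@le_trans _ _ (\sum_(k < nodes T) (regret (node_pt T k) T +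
          2 * D * potential2 T (state (node_pt T k) T)))).
  apply: ler_sum => k _; rewrite lerDl mulr_ge0 ?mulr_ge0//.
  by rewrite addr_ge0// potential_ge0.
apply: le_trans (sum_regret T T) _; rewrite mulrC ler_pM2r//.
have T1 : T%:R * 2 ^- T <= 1 :> R.
  rewrite ler_pdivrMr ?exprn_gt0// mul1r -natrX ler_nat ltnW//.
  exact: ltn_expl.
have T0 : 0 <= 2 ^- T :> R by rewrite invr_ge0 exprn_ge0.
have hP := potential_le T (@in_ball R d) d0.
have dR : 1 <= d%:R :> R by rewrite ler1n.
have p5 : 1 <= 5 ^+ d :> R by rewrite exprn_ege1//; lra.
have p56 := @exp5_linear_le R d.
(* [2 * D <= 8 * 5 ^ d], and there are two candidate sets, hence 16. *)
have hP2 : 2 * D * potential2 T (@in_ball R d, @in_ball R d) <=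
    16 * 5 ^+ d * (d%:R * (644 + 2 * d%:R)).
  rewrite /potential2/=; set P := potential _ _ in hP *.
  have P0 : 0 <= P by exact: potential_ge0.
  have : 5 ^+ d * P <= 5 ^+ d * (d%:R * (644 + 2 * d%:R)).
    by rewrite ler_wpM2l// exprn_ge0.
  have : 0 <= (5 ^+ d - 1) * P by rewrite mulr_ge0// subr_ge0.
  lra.
have hd : 5 ^+ d * (644 + 2 * d%:R) <= 644 * 6 ^+ d :> R.
  have : 0 <= 5 ^+ d * d%:R :> R by rewrite mulr_ge0// exprn_ge0.
  lra.
have : 16 * 5 ^+ d * (d%:R * (644 + 2 * d%:R)) <= 16 * 644 * (d%:R * 6 ^+ d) :> R.
  have : d%:R * (5 ^+ d * (644 + 2 * d%:R)) <= d%:R * (644 * 6 ^+ d) :> R.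
    by rewrite ler_wpM2l.
  lra.
(* The remaining errors, at most [2 + 4], fit into [16 * (d * 6 ^ d)], which raises 644 to 645. *)
have : 1 <= d%:R * 6 ^+ d :> R.
  by rewrite mulr_ege1// exprn_ege1//; lra.
lra.
Qed.

End Instance.
End Policy.

(** In dimension 0 the grid degenerates ([mesh i = 0]) and the claimed bound is 0, but all
    valuations vanish. *)
Lemma realized_regret_dim0 (R : realType) (Omega : Type) (A : policy R 0 Omega)
  w s b x T : realized_regret A w s b x T = 0.
Proof.
rewrite /realized_regret !big1 ?subrr// => t _.
  by rewrite /gft /dotv !big_ord0 subrr if_same.
by rewrite /dotv !big_ord0 subrr maxxx.
Qed.

Theorem theorem4p8 (R : realType) :
  exists C : R, 0 <= C /\
  forall d : nat,
  exists (dO : measure_display) (Omega : measurableType dO)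
         (P : probability Omega R) (A : policy R d Omega),
    (* per-round budget balance: p_t <= q_t in every round *)
    (forall (s b : 'rV[R]_d) (x : nat -> 'rV[R]_d) (w : Omega) (t : nat),
        in_ball s -> in_ball b -> (forall k, in_ball (x k)) ->
        (prices A w s b x t).1 <= (prices A w s b x t).2) /\
    (* regret bound, uniformly over horizons T and (oblivious) instances *)
    (forall (T : nat) (s b : 'rV[R]_d) (x : nat -> 'rV[R]_d),
        in_ball s -> in_ball b -> (forall k, in_ball (x k)) ->
        measurable_fun setT (fun w => realized_regret A w s b x T) /\
        (\int[P]_w (realized_regret A w s b x T)%:E <=
           (C * (d%:R * 6 ^+ d))%:E)%E).
Proof.
exists (16 * 645); split=> // d; exists _, _, (uniform_prob (@ltr01 R)), learner.
split=> [s b x w t _ _ _|T s b x bs bb bx]; first by rewrite pricesE.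
have [d0|] := posnP d; last first.
  by move=> d0; apply (@regret_bound R d s b x bs bb bx d0 T).
subst d; split.
  rewrite (_ : (fun w => _) = cst 0) //.
  by apply/funext => w; exact: realized_regret_dim0.
by rewrite mul0r mulr0 integral0_eq// => w _; rewrite realized_regret_dim0.
Qed.
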